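(* Let $t \ge 1$ be an integer and let $G$ be a $(2t+1)$-regular graph. A set $X \subseteq E(G)$ is $(2+\frac{1}{t})$-minimal if and only if $G$ has a $t$-factor and $X$ is an (inclusion-)minimal set of edges such that $G - X$ is bipartite.
   Context: Graphs are finite and may have parallel edges but no loops. $G-X$ is the graph obtained by deleting the edges in $X$. A $t$-factor is a spanning $t$-regular subgraph. A signed graph $(G,\sigma)$ is a graph $G$ with a function (signature) $\sigma: E(G)\to\{\pm1\}$; $N_\sigma=\{e:\sigma(e)=-1\}$. Each edge $e=uv$ is divided into two half-edges $h_e^u$ (incident with $u$) and $h_e^v$ (incident with $v$); $H(G)$ is the set of half-edges, $H(v)$ the set of half-edges incident with $v$, and $e_h$ the edge containing the half-edge $h$. An orientation of $(G,\sigma)$ is a function $\tau: H(G)\to\{\pm1\}$ with $\tau(h_e^u)\tau(h_e^v) = -\sigma(e)$ for each edge $e=uv$. Given an orientation $\tau$, the boundary of $f:E(G)\to\mathbb{R}$ is $\delta f(v)=\sum_{h\in H(v)}\tau(h)f(e_h)$. For real $r\ge 2$, $f$ is an $r$-flow on $(G,\sigma)$ if, for every edge $e$, $f(e)=0$ or $1\le |f(e)|\le r-1$, and $\delta f(v)=0$ for all $v\in V(G)$; it is nowhere-zero if $f(e)\ne 0$ for all $e$. $(G,\sigma)$ admits a nowhere-zero $r$-flow if one exists for some orientation. $F_c((G,\sigma))=\inf\{r : (G,\sigma)\text{ admits a nowhere-zero }r\text{-flow}\}$ (it is $\infty$ if there is no such $r$). For real $r\ge 2$, a set $X\subseteq E(G)$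 is $r$-minimal if 1) the signature $\sigma$ of $G$ with $N_\sigma=X$ satisfies $F_c((G,\sigma))=r$, and 2) $F_c((G,\sigma'))\neq r$ for every signature $\sigma'$ of $G$ with $N_{\sigma'}$ a proper subset of $X$. *)

(* Defs.v *)
From HB Require Import structures.
From mathcomp Require Import all_boot all_order all_algebra.
From mathcomp Require Import all_classical all_reals ereal.

Set Implicit Arguments.
Unset Strict Implicit.
Unset Printing Implicit Defensive.

Import Order.TTheory GRing.Theory Num.Theory.

Local Open Scope classical_set_scope.
Local Open Scope ring_scope.

(* Parallel edges are allowed, since [ends] need not be injective; there are
   no loops, since every edge has exactly two ends. *)
Record mgraph := MGraph {
  vertex : finType;
  edge : finType;
  ends : edge -> {set vertex};
  card_ends : forall e, #|ends e| = 2%N }.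

Definition degree (G : mgraph) (v : vertex G) : nat :=
  #|[set e : edge G | v \in ends e]%SET|.

Definition regular (d : nat) (G : mgraph) : Prop :=
  forall v : vertex G, degree v = d.

Definition spanning_subgraph (G : mgraph) (F : {set edge G}) : mgraph :=
  @MGraph (vertex G) {e : edge G | e \in F} (fun e => ends (val e))
    (fun e => card_ends (val e)).

Definition del_edges (G : mgraph) (X : {set edge G}) : mgraph :=
  spanning_subgraph (~: X)%SET.

Definition has_factor (t : nat) (G : mgraph) : Prop :=
  exists F : {set edge G}, regular t (spanning_subgraph F).

Definition bipartite (G : mgraph) : bool :=
  [exists A : {set vertex G}, forall e : edge G, #|ends e :&: A| == 1%N].

(* The half-edge of [e] at its end [u] is the pair [(u, e)]; as there are no
   loops, every edge has exactly two half-edges. *)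
Definition half_edge (G : mgraph) : finType :=
  {h : vertex G * edge G | h.1 \in ends h.2}.

Definition hvertex (G : mgraph) (h : half_edge G) : vertex G := (val h).1.
Definition hedge (G : mgraph) (h : half_edge G) : edge G := (val h).2.

Definition sign_valued (T : Type) (s : T -> int) : Prop :=
  forall x, s x = 1 \/ s x = -1.

Definition is_signature (G : mgraph) (sigma : edge G -> int) : Prop :=
  sign_valued sigma.

Definition neg_edges (G : mgraph) (sigma : edge G -> int) : {set edge G} :=
  [set e | sigma e == -1]%SET.

Definition is_orientation (G : mgraph) (sigma : edge G -> int)
    (tau : half_edge G -> int) : Prop :=
  sign_valued tau /\
  forall h h' : half_edge G, h != h' -> hedge h = hedge h' ->
    tau h * tau h' = - sigma (hedge h).

Definition boundary (R : realType) (G : mgraph) (tau : half_edge G -> int)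
    (f : edge G -> R) (v : vertex G) : R :=
  \sum_(h : half_edge G | hvertex h == v) (tau h)%:~R * f (hedge h).

Definition is_flow (R : realType) (r : R) (G : mgraph)
    (tau : half_edge G -> int) (f : edge G -> R) : Prop :=
  (forall e, f e = 0 \/ 1 <= `|f e| <= r - 1) /\
  (forall v, boundary tau f v = 0).

Definition nowhere_zero (R : realType) (G : mgraph) (f : edge G -> R) : Prop :=
  forall e, f e != 0.

Definition admits_nz_flow (R : realType) (r : R) (G : mgraph)
    (sigma : edge G -> int) : Prop :=
  exists tau : half_edge G -> int, is_orientation sigma tau /\
    exists f : edge G -> R, is_flow r tau f /\ nowhere_zero f.

(* The infimum of the empty set is [+oo]. *)
Definition circular_flow_number (R : realType) (G : mgraph)
    (sigma : edge G -> int) : \bar R :=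
  ereal_inf [set r%:E | r in [set r : R | 2 <= r /\ admits_nz_flow r sigma]].

Definition r_minimal (R : realType) (r : R) (G : mgraph)
    (X : {set edge G}) : Prop :=
  (exists sigma : edge G -> int, is_signature sigma /\ neg_edges sigma = X /\
     circular_flow_number R sigma = r%:E) /\
  (forall sigma' : edge G -> int, is_signature sigma' ->
     neg_edges sigma' \proper X -> circular_flow_number R sigma' <> r%:E).

(* Main.v *)
Require Import Defs.
From HB Require Import structures.
From mathcomp Require Import all_boot all_order all_algebra.
From mathcomp Require Import all_classical all_reals ereal.
From mathcomp Require Import zify ring lra.

Import Order.TTheory GRing.Theory Num.Theory.

Local Open Scope ring_scope.

(** Let [r = 2 + 1/t].  Everything follows from a description of the signatures
    of circular flow number [r] on a [(2t+1)]-regular graph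
    ([circular_flow_numberP]): they exist only if [G] has a [t]-factor, and then
    their sets of negative edges are exactly the complements [uncut A] of the
    cuts of [G].  As [G - X] is bipartite iff [X] contains some [uncut A], the
    minimal sets of either kind coincide.

    The description comes from looking at one vertex of a nowhere-zero
    [s]-flow.  Of its [2t+1] half-edges, at least [t+1] carry flow of one
    direction, and at most [t] carry flow of the other; the former transport at
    least [t+1], the latter at most [t(s-1)], so [s >= r].  If [s = r] there is
    equality everywhere: [t+1] half-edges have value [1] in one direction, and
    [t] half-edges have value [1 + 1/t] in the other.  The edges of value
    [1 + 1/t] then form a [t]-factor, and, with [A] the set of vertices whose
    majority direction is outward, the direction at a half-edge is determined by
    membership of its vertex in [A] and of its edge in the factor.  Hence an edge
    is negative iff its ends lie on the same side of [A].  Reading this backwards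
    constructs an [r]-flow from a [t]-factor and a set [A] ([cut_admits_flow]).

    The circular flow number is an infimum, so the argument is run for all [s]
    slightly larger than [r]: the values at each vertex are then still separated
    by the threshold [1 + 1/(2t)] ([majority_light_minority_heavy]), and already
    such [s]-flows yield the factor and the cut ([flow_factor_cut]). *)

(** * Half-edges and cuts *)

Definition uncut {G : mgraph} (A : {set vertex G}) : {set edge G} :=
  [set e | #|ends e :&: A| != 1%N].

Definition half_edges_at {G : mgraph} (v : vertex G) : {set half_edge G} :=
  [set h | hvertex h == v].

Lemma half_edge_inj {G : mgraph} {h h' : half_edge G} :
  hvertex h = hvertex h' -> hedge h = hedge h' -> h = h'.
Proof.
move=> ev ee; apply: val_inj.
by rewrite [LHS]surjective_pairing [RHS]surjective_pairing; congr pair.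
Qed.

Lemma hvertex_ends {G : mgraph} (h : half_edge G) : hvertex h \in ends (hedge h).
Proof. exact: (valP h). Qed.

Lemma ends_half_edges {G : mgraph} {h h' : half_edge G} :
  h != h' -> hedge h = hedge h' ->
  hvertex h != hvertex h' /\ ends (hedge h) = [set hvertex h; hvertex h'].
Proof.
move=> nh ee.
have nv : hvertex h != hvertex h'.
  by apply: contra nh => /eqP ev; apply/eqP/half_edge_inj.
split=> //; apply/esym/eqP; rewrite eqEcard cards2 nv card_ends leqnn andbT.
by rewrite finset.subUset !finset.sub1set hvertex_ends ee hvertex_ends.
Qed.

Lemma edge_half_edges {G : mgraph} (e : edge G) :
  exists h h' : half_edge G, [/\ h != h', hedge h = e & hedge h' = e].
Proof.
have /eqP/cards2P[u [v [nuv Ee]]] := card_ends e.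
have hu : u \in ends e by rewrite Ee finset.set21.
have hv : v \in ends e by rewrite Ee finset.set22.
exists (Sub (u, e) hu), (Sub (v, e) hv); split=> //.
by rewrite -val_eqE /= xpair_eqE (negbTE nuv).
Qed.

Lemma mem_uncut {G : mgraph} {A : {set vertex G}} {h h' : half_edge G} :
  h != h' -> hedge h = hedge h' ->
  (hedge h \in uncut A) = ((hvertex h \in A) == (hvertex h' \in A)).
Proof.
move=> nh ee; have [nv Ee] := ends_half_edges nh ee.
rewrite inE Ee finset.setIUl cardsU.
have single x : #|[set x] :&: A| = (x \in A).
  have [xA|xA] := boolP (x \in A).
    by rewrite (finset.setIidPl _) ?cards1 ?finset.sub1set.
  rewrite (_ : _ :&: _ = finset.set0) ?cards0 //; apply/setP => y.
  by rewrite !inE; case: eqP => // ->; rewrite (negbTE xA).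
rewrite (_ : [set hvertex h] :&: A :&: ([set hvertex h'] :&: A) = finset.set0).
  by rewrite cards0 !single; case: (_ \in A); case: (_ \in A).
apply/setP => y; rewrite !inE; case: eqP => //= ->.
by rewrite (negbTE nv) andbF.
Qed.

Lemma card_half_edges_in {G : mgraph} (F : {set edge G}) (v : vertex G) :
  #|[set h in half_edges_at v | hedge h \in F]| =
  degree (G := spanning_subgraph F) v.
Proof.
rewrite /degree -[RHS](card_imset _ val_inj) /=.
transitivity
    #|[set hedge h | h in [set h in half_edges_at v | hedge h \in F]]|; last first.
  congr #|pred_of_set _|; apply/setP => e; apply/imsetP/imsetP.
    move=> [h]; rewrite !inE => /andP[/eqP hv hF] ->.
    by exists (Sub (hedge h) hF); rewrite ?inE //= -hv hvertex_ends.
  move=> [[e' eF]]; rewrite inE /= => ve ->.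
  by exists (Sub (v, e') ve); rewrite // !inE /hvertex /hedge /= eqxx.
apply/esym/card_in_imset => h h'; rewrite !inE => /andP[/eqP hv _] /andP[/eqP hv' _].
by apply: half_edge_inj; rewrite hv hv'.
Qed.

Lemma card_half_edges_at {G : mgraph} (v : vertex G) :
  #|half_edges_at v| = degree v.
Proof.
transitivity #|[set hedge h | h in half_edges_at v]|.
  by apply/esym/card_in_imset; move=> h h'; rewrite !inE => /eqP hv /eqP hv';
     apply: half_edge_inj; rewrite hv hv'.
congr #|pred_of_set _|; apply/setP => e; rewrite inE; apply/imsetP/idP.
  by move=> [h]; rewrite inE => /eqP <- ->; exact: hvertex_ends.
by move=> ve; exists (Sub (v, e) ve); rewrite // !inE /hvertex /= eqxx.
Qed.

Lemma bipartite_del_edgesP {G : mgraph} (Y : {set edge G}) :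
  reflect (exists A, uncut A \subset Y) (bipartite (del_edges Y)).
Proof.
apply: (iffP existsP) => -[A hA]; exists A.
  apply/fintype.subsetP => e; rewrite inE; apply: contraR => eY.
  have eC : e \in ~: Y by rewrite inE.
  exact: (forallP hA (Sub e eC)).
apply/forallP => -[e /=]; rewrite inE; apply: contraR => hc.
by apply: (fintype.subsetP hA); rewrite inE.
Qed.

(** * The values of a flow around a vertex of odd degree *)

Section OddBalance.

Context {R : realFieldType} {I : finType} {P N : {set I}} {a : I -> R}.
Context {c : R} {t : nat}.
Hypothesis a_bounds : forall i, 1 <= a i <= c.
Hypothesis balance : \sum_(i in P) a i = \sum_(i in N) a i.
Hypothesis card_PN : (#|P| + #|N| = 2 * t + 1)%N.
Hypothesis major : (#|N| < #|P|)%N.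

Lemma card_le_sum (S : {set I}) : #|S|%:R <= \sum_(i in S) a i.
Proof.
rewrite -sumr_const; apply: ler_sum => i _; by case/andP: (a_bounds i).
Qed.

Lemma sum_le_card (S : {set I}) : \sum_(i in S) a i <= #|S|%:R * c.
Proof.
rewrite mulr_natl -sumr_const; apply: ler_sum => i _.
by case/andP: (a_bounds i).
Qed.

Lemma bound_ge1 : 1 <= c.
Proof.
have /card_gt0P[i _] : (0 < #|P|)%N by lia.
by case/andP: (a_bounds i); apply: le_trans.
Qed.

(** The majority transports at least [t + 1], the minority at most [t * c]. *)
Lemma majority_forces_bound : t%:R + 1 <= t%:R * c.
Proof.
have hP := card_le_sum P; rewrite balance in hP; have hN := sum_le_card N.
have c1 := bound_ge1.
have lP : (t + 1)%:R <= #|P|%:R :> R by rewrite ler_nat; lia.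
have lN : #|N|%:R <= t%:R :> R by rewrite ler_nat; lia.
have : #|N|%:R * c <= t%:R * c by apply: ler_wpM2r => //; lra.
by rewrite natrD in lP; lra.
Qed.

Hypothesis t_gt0 : (0 < t)%N.
Hypothesis c_small : t%:R * c < t%:R + 1 + (2 * t%:R)^-1.

(** With at most [t - 1] half-edges in [N] there would be at least [t + 2] in
    [P], but [t - 1] values of size [c] sum to less than [t + 2]: the bound
    [c_small] leaves a slack of only [1/(2t)]. *)
Lemma card_minority : #|N| = t.
Proof.
have hP := card_le_sum P; rewrite balance in hP; have hN := sum_le_card N.
have c1 := bound_ge1.
have d1 : (2 * t%:R)^-1 <= 1 :> R.
  by rewrite invf_le1 -?natrM ?ler1n ?ltr0n; lia.
apply/eqP; rewrite eqn_leq; apply/andP; split; first by lia.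
rewrite leqNgt; apply/negP => lt.
have lP : (t + 2)%:R <= #|P|%:R :> R by rewrite ler_nat; lia.
have lN : #|N|%:R + 1 <= t%:R :> R by rewrite natr1 ler_nat; lia.
have : (#|N|%:R + 1) * c <= t%:R * c by apply: ler_wpM2r => //; lra.
rewrite natrD in lP; rewrite mulrDl mul1r => le.
by have small := c_small; lra.
Qed.

(** Each value is bounded by letting all the others be extremal in the balance.
    Both estimates meet at [1 + 1/(2t)], halfway between the values [1] and
    [1 + 1/t] of the exact case; it is this common threshold that lets heaviness
    be a property of edges, independent of the end from which they are seen. *)
Lemma majority_light_minority_heavy :
  (forall i, i \in P -> a i < 1 + (2 * t%:R)^-1) /\
  (forall i, i \in N -> 1 + (2 * t%:R)^-1 < a i).
Proof.
have cN := card_minority; have small := c_small.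
have cP : #|P| = t.+1 by lia.
have c1 := majority_forces_bound.
have tR : 0 < t%:R :> R by rewrite ltr0n.
split=> i hi.
  have hN := sum_le_card N.
  have hP := card_le_sum (P :\ i).
  have cPi : #|P :\ i| = t by have := cardsD1 i P; rewrite hi; lia.
  rewrite -balance (big_setD1 i hi) /= cN in hN.
  by rewrite cPi in hP; lra.
have hP := card_le_sum P.
have hN := sum_le_card (N :\ i).
have cNi : (#|N :\ i| + 1 = t)%N by have := cardsD1 i N; rewrite hi; lia.
have cNi' : #|N :\ i|%:R = t%:R - 1 :> R by rewrite -cNi natrD addrK.
rewrite balance (big_setD1 i hi) /= cP -natr1 in hP.
rewrite cNi' mulrBl mul1r in hN.
(* [c] exceeds the threshold [1 + 1/(2t)] by at least [1/(2t)], while the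
   balance gives [a i >= c - (t c - t - 1) > c - 1/(2t)]. *)
have c2 : 1 + (2 * t%:R)^-1 + (2 * t%:R)^-1 <= c.
  rewrite -(ler_pM2l tR); apply: le_trans c1.
  by rewrite le_eqVlt; apply/orP; left; apply/eqP; field; rewrite gt_eqF.
lra.
Qed.

End OddBalance.

(** * From flows to factors and cuts *)

Lemma intr_sign_cases {T : Type} {s : T -> int} :
  sign_valued s -> forall (R : realDomainType) x,
  (s x)%:~R = 1 :> R \/ (s x)%:~R = -1 :> R.
Proof. by move=> hs R x; case: (hs x) => ->; [left|right; rewrite mulrN1z]. Qed.

Section FlowAtVertex.

Context {R : realType} {G : mgraph} {t : nat}.
Hypothesis hG : regular (2 * t + 1) G.
Context {s : R} {sigma : edge G -> int} {tau : half_edge G -> int}.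
Hypothesis tau_sigma : is_orientation sigma tau.
Context {f : edge G -> R}.
Hypotheses (f_flow : is_flow s tau f) (f_nz : nowhere_zero f).

(** The direction in which flow is carried: it is invariant under reversing an edge
    in [tau] while changing the sign of [f] there. *)
Definition outward (h : half_edge G) : bool := 0 < (tau h)%:~R * f (hedge h).

Definition outs (v : vertex G) : {set half_edge G} :=
  [set h in half_edges_at v | outward h].

Definition ins (v : vertex G) : {set half_edge G} :=
  [set h in half_edges_at v | ~~ outward h].

Lemma flow_bounds (h : half_edge G) : 1 <= `|f (hedge h)| <= s - 1.
Proof. by case: (f_flow.1 (hedge h)) => // /eqP; rewrite (negbTE (f_nz _)). Qed.

Lemma outwardE (h : half_edge G) :
  (tau h)%:~R * f (hedge h) = (-1) ^+ (~~ outward h) * `|f (hedge h)|.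
Proof.
have e : `|(tau h)%:~R * f (hedge h)| = `|f (hedge h)|.
  rewrite normrM; case: (intr_sign_cases (proj1 tau_sigma) R h) => ->.
    by rewrite normr1 mul1r.
  by rewrite normrN1 mul1r.
rewrite -e /outward; case: ltP => h0 /=; first by rewrite expr0 mul1r gtr0_norm.
by rewrite expr1 ler0_norm // mulN1r opprK.
Qed.

Lemma flow_balance (v : vertex G) :
  \sum_(h in outs v) `|f (hedge h)| = \sum_(h in ins v) `|f (hedge h)|.
Proof.
have := f_flow.2 v; rewrite /boundary (bigID outward) /=.
move/eqP; rewrite addr_eq0 -sumrN => /eqP.
rewrite (eq_bigl (fun h => h \in outs v)) => [|h]; last by rewrite !inE.
rewrite (eq_bigr (fun h => `|f (hedge h)|)) => [->|h]; last first.
  by rewrite inE => /andP[_ ho]; rewrite outwardE ho expr0 mul1r.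
rewrite (eq_bigl (fun h => h \in ins v)) => [|h]; last by rewrite !inE.
by apply: eq_bigr => h; rewrite inE => /andP[_ ho];
   rewrite outwardE ho expr1 mulN1r opprK.
Qed.

Lemma card_outs_ins (v : vertex G) : (#|outs v| + #|ins v| = 2 * t + 1)%N.
Proof.
rewrite -(hG v) -card_half_edges_at.
rewrite -(cardsID [set h | outward h] (half_edges_at v)).
by congr (_ + _)%N; apply: eq_card => h; rewrite !inE // andbC.
Qed.

Lemma flow_value_ge (v : vertex G) : t%:R + 1 <= t%:R * (s - 1).
Proof.
have cd := card_outs_ins v.
have [lt|lt|eq] := ltngtP #|ins v| #|outs v|; last by lia.
  exact: majority_forces_bound flow_bounds (flow_balance v) cd lt.
apply: majority_forces_bound flow_bounds (esym (flow_balance v)) _ lt.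
by rewrite addnC.
Qed.

Hypothesis t_gt0 : (0 < t)%N.
Hypothesis s_small : t%:R * (s - 1) < t%:R + 1 + (2 * t%:R)^-1.

Definition heavy : {set edge G} := [set e | 1 + (2 * t%:R)^-1 < `|f e|].

Definition sources : {set vertex G} := [set v | (#|ins v| < #|outs v|)%N].

(** At a vertex of [sources] the outward half-edges are the majority, hence
    light, and the inward ones heavy; elsewhere it is the other way round. *)
Lemma outward_heavy (h : half_edge G) :
  outward h = (hvertex h \in sources) (+) (hedge h \in heavy).
Proof.
set v := hvertex h; have cd := card_outs_ins v.
have hv : (h \in outs v) = outward h by rewrite !inE eqxx.
have hv' : (h \in ins v) = ~~ outward h by rewrite !inE eqxx.
have [lt|lt|eq] := ltngtP #|ins v| #|outs v|; last by lia.
- have [lo hi] := majority_light_minority_heavy flow_bounds (flow_balance v)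
    cd lt t_gt0 s_small.
  rewrite !inE lt /=; case: (boolP (outward h)) hv hv' => _ /= hP hN.
    by rewrite ltNge (ltW (lo _ hP)).
  by rewrite (hi _ hN).
- rewrite addnC in cd.
  have [lo hi] := majority_light_minority_heavy flow_bounds
    (esym (flow_balance v)) cd lt t_gt0 s_small.
  rewrite !inE ltnNge (ltnW lt) /=.
  case: (boolP (outward h)) hv hv' => _ /= hP hN.
    by rewrite (hi _ hP).
  by rewrite ltNge (ltW (lo _ hN)).
Qed.

Lemma heavy_factor : regular t (spanning_subgraph heavy).
Proof.
move=> v; rewrite -card_half_edges_in; have cd := card_outs_ins v.
have [lt|lt|eq] := ltngtP #|ins v| #|outs v|; last by lia.
- rewrite -(card_minority flow_bounds (flow_balance v) cd lt t_gt0 s_small).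
  apply: eq_card => h; rewrite !inE; case: eqP => //= hv.
  by rewrite outward_heavy hv !inE lt /= negbK.
- have cd' : (#|ins v| + #|outs v| = 2 * t + 1)%N by rewrite addnC.
  rewrite -(card_minority flow_bounds (esym (flow_balance v)) cd' lt t_gt0
    s_small).
  apply: eq_card => h; rewrite !inE; case: eqP => //= hv.
  by rewrite outward_heavy hv !inE ltnNge (ltnW lt).
Qed.

(** An edge is negative iff its two half-edges have the same direction; both have
    the same heaviness, so by [outward_heavy] their directions agree iff both or
    none of the ends are in [sources]. *)
Lemma neg_edges_sources : neg_edges sigma = uncut sources.
Proof.
apply/setP => e; have [h [h' [nh he he']]] := edge_half_edges e.
have ee : hedge h = hedge h' by rewrite he he'.
have outward_tau k : hedge k = e -> outward k = ((tau k == 1) == (0 < f e)).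
  move=> <-; rewrite /outward; have nz := f_nz (hedge k).
  case: (tau_sigma.1 k) => ->; first by rewrite mul1r; case: (0 < _).
  by rewrite mulrN1z mulN1r oppr_gt0 ltNge le0r (negbTE nz); case: (0 < _).
have neg_tau : (sigma e == -1) = ((tau h == 1) == (tau h' == 1)).
  have := tau_sigma.2 _ _ nh ee; rewrite he => /esym/eqP; rewrite eqr_oppLR.
  move=> /eqP ->.
  by case: (tau_sigma.1 h) => ->; case: (tau_sigma.1 h') => ->.
rewrite [LHS]inE neg_tau -[in RHS]he (mem_uncut nh ee).
have := outward_heavy h; have := outward_heavy h'.
rewrite (outward_tau _ he) (outward_tau _ he') he he'.
case: (tau h == 1); case: (tau h' == 1); case: (0 < f e);
  case: (hvertex h \in _); case: (hvertex h' \in _);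
  by case: (e \in heavy).
Qed.

End FlowAtVertex.

Lemma flow_factor_cut {R : realType} {t : nat} {G : mgraph} {s : R}
    {sigma : edge G -> int} :
  (0 < t)%N -> regular (2 * t + 1) G ->
  t%:R * (s - 1) < t%:R + 1 + (2 * t%:R)^-1 -> admits_nz_flow s sigma ->
  has_factor t G /\ exists A, neg_edges sigma = uncut A.
Proof.
move=> t_gt0 hG s_small [tau [ht [f [hf nz]]]]; split.
  by eexists; exact: (heavy_factor hG ht hf nz t_gt0 s_small).
eexists; exact: (neg_edges_sources hG ht hf nz t_gt0 s_small).
Qed.

(** * From factors and cuts to flows *)

(** Edges of [F] get value [1 + 1/t] and the others value [1].  At each vertex the
    [t + 1] half-edges outside [F] point one way and the [t] half-edges in [F]
    the other, which balances since [t + 1 = t (1 + 1/t)]. *)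
Lemma cut_admits_flow {R : realType} {t : nat} {G : mgraph} {F : {set edge G}}
    {A : {set vertex G}} {sigma : edge G -> int} :
  (0 < t)%N -> regular (2 * t + 1) G -> regular t (spanning_subgraph F) ->
  is_signature sigma -> neg_edges sigma = uncut A ->
  admits_nz_flow (2 + t%:R^-1 : R) sigma.
Proof.
move=> t_gt0 hG hF hs hA.
have tR : 0 < t%:R :> R by rewrite ltr0n.
have tV : 0 < t%:R^-1 :> R by rewrite invr_gt0.
pose tau h : int := (-1) ^+ ((hvertex h \in A) (+) (@hedge G h \in F)).
pose f e : R := if e \in F then 1 + t%:R^-1 else 1.
exists tau; split; first split.
- by move=> h; rewrite /tau; case: (_ (+) _); [right|left].
- move=> h h' nh ee.
  have : (hedge h \in neg_edges sigma) = (hedge h \in uncut A) by rewrite hA.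
  rewrite (mem_uncut nh ee) inE /tau ee.
  case: (hs (hedge h')) => ->; case: (_ \in A); case: (_ \in A);
    by case: (_ \in F).
exists f; split; first split; last first.
- by move=> e; rewrite /f; case: ifP => _; rewrite ?oner_neq0 // gt_eqF //; lra.
- move=> v.
  rewrite /boundary.
  (* Count every half-edge with value [1], then correct those in [F], which
     contribute [- (1 + 1/t)] instead. *)
  have -> : \sum_(h : half_edge G | hvertex h == v) (tau h)%:~R * f (hedge h) =
      (-1) ^+ (v \in A) *
      (\sum_(h in half_edges_at v) 1 -
       \sum_(h in half_edges_at v | hedge h \in F) (2 + t%:R^-1)) :> R.
    rewrite [X in _ - X]big_mkcondr /= -sumrB big_distrr /=.
    apply: eq_big => [h|h /eqP hv]; first by rewrite inE.
    rewrite /tau /f hv; case: (v \in A); case: (_ \in F);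
      rewrite /= ?expr0 ?expr1 ?mulrN1z; ring.
  rewrite !sumr_const card_half_edges_at hG.
  rewrite (_ : #|_| = t); last first.
    rewrite -(hF v) -card_half_edges_in.
    by apply: eq_card => h; rewrite unfold_in !inE.
  rewrite -[_ *+ t]mulr_natl natrD natrM.
  by rewrite (_ : _ - _ = 0) ?mulr0 //; field; rewrite gt_eqF.
- move=> e; right; rewrite /f; case: ifP => _;
    by rewrite ger0_norm; lra.
Qed.

(** * The signatures of circular flow number [2 + 1/t] *)

Section CircularFlowNumber.

Context {R : realType} {t : nat} {G : mgraph}.
Hypotheses (t_gt0 : (0 < t)%N) (hV : (0 < #|vertex G|)%N).
Hypothesis hG : regular (2 * t + 1) G.

(** From left to right, the infimum [2 + 1/t] provides [s]-flows with [s] below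
    [2 + 1/t + 1/(2t^2)], the range in which [flow_factor_cut] applies. *)
Lemma circular_flow_numberP {sigma : edge G -> int} :
  is_signature sigma ->
  circular_flow_number R sigma = (2 + t%:R^-1)%:E <->
  has_factor t G /\ exists A, neg_edges sigma = uncut A.
Proof.
move=> hs; have tR : 0 < t%:R :> R by rewrite ltr0n.
have tV : 0 < t%:R^-1 :> R by rewrite invr_gt0.
split=> [hc|[[F hF] [A hA]]].
  have : (circular_flow_number R sigma <
          (2 + t%:R^-1 + (2 * t%:R)^-1 / t%:R)%:E)%E.
    rewrite hc lte_fin ltrDl divr_gt0 ?invr_gt0 //; lra.
  case/ereal_inf_lt => _ [s [_ fl] <-]; rewrite lte_fin => lt.
  apply: flow_factor_cut t_gt0 hG _ fl.
  have : t%:R * (s - 1) < t%:R * (1 + t%:R^-1 + (2 * t%:R)^-1 / t%:R).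
    by rewrite ltr_pM2l //; lra.
  move/lt_le_trans; apply; rewrite le_eqVlt; apply/orP; left; apply/eqP.
  by field; rewrite gt_eqF.
apply/eqP; rewrite eq_le; apply/andP; split.
  apply: ereal_inf_lbound; exists (2 + t%:R^-1) => //; split; first by lra.
  exact: cut_admits_flow t_gt0 hG hF hs hA.
apply: le_ereal_inf_tmp => _ [s [_ [tau [ht [f [hf nz]]]]] <-].
have /card_gt0P[v _] := hV.
have := flow_value_ge hG ht hf nz v.
rewrite lee_fin => le.
rewrite -(ler_pM2l tR).
have : t%:R * (2 + t%:R^-1) = 2 * t%:R + 1 :> R by field; rewrite gt_eqF.
by move=> ->; lra.
Qed.

End CircularFlowNumber.

Definition signature_of {G : mgraph} (Y : {set edge G}) (e : edge G) : int :=
  if e \in Y then -1 else 1.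

Lemma signature_ofP {G : mgraph} (Y : {set edge G}) :
  is_signature (signature_of Y).
Proof. by move=> e; rewrite /signature_of; case: ifP; [right|left]. Qed.

Lemma neg_edges_signature_of {G : mgraph} (Y : {set edge G}) :
  neg_edges (signature_of Y) = Y.
Proof. by apply/setP => e; rewrite inE /signature_of; case: ifP. Qed.

Theorem theorem5p3 (R : realType) (t : nat) (ht : (1 <= t)%N)
    (G : mgraph) (hV : (0 < #|vertex G|)%N) (hG : regular (2 * t + 1) G)
    (X : {set edge G}) :
  r_minimal (2 + t%:R^-1 : R) X <->
  has_factor t G /\
  minset (fun Y : {set edge G} => bipartite (del_edges Y)) X.
Proof.
have FcP := @circular_flow_numberP R t G ht hV hG.
split=> [[[sigma [hs [<- hc]]] hmin]|[hF]].
  have [hF [A hA]] := (FcP _ hs).1 hc; split=> //.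
  apply/minsetP; split; first by apply/bipartite_del_edgesP; exists A; rewrite hA.
  move=> Y /bipartite_del_edgesP[B hB] hY; apply/eqP; rewrite eqEproper hY /=.
  apply/negP => prY.
  (* [Y] itself need not be of the form [uncut B], so [uncut B] is the set that
     contradicts the minimality of [neg_edges sigma]. *)
  apply: (hmin (signature_of (uncut B))); first exact: signature_ofP.
    by rewrite neg_edges_signature_of; apply: sub_proper_trans hB prY.
  apply/FcP; first exact: signature_ofP.
  by split=> //; exists B; rewrite neg_edges_signature_of.
case/minsetP => /bipartite_del_edgesP[A hA] hmin.
have eA : uncut A = X.
  by apply: hmin => //; apply/bipartite_del_edgesP; exists A.
split.
  exists (signature_of X); rewrite neg_edges_signature_of.
  split; first exact: signature_ofP.
  split=> //; apply/FcP; first exact: signature_ofP.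
  by split=> //; exists A; rewrite neg_edges_signature_of.
move=> sigma hs pr /(FcP _ hs)[_ [B hB]].
move: (pr); rewrite properE => /andP[sub /negP]; apply.
rewrite (hmin (neg_edges sigma)) //.
by apply/bipartite_del_edgesP; exists B; rewrite hB.
Qed.
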